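(* Let $\mathbb{K}$ be a field and suppose $\Delta$ is a PR complex (over $\mathbb{K}$) on vertex set $V$ with degree type $\mathbf{d}=(d_p,\dots,d_1)$. Let $\lambda$ be a positive integer. The complex $f^\lambda(\Delta)$ is PR (over $\mathbb{K}$) with degree type $\lambda\mathbf{d}=(\lambda d_p,\dots,\lambda d_1)$.
   Context: The operation $f^\lambda$: let $\Delta$ be a simplicial complex on a finite vertex set $V$ with facets $F_1,\dots,F_m$. Let $V^\lambda=\{u_x^1,\dots,u_x^\lambda:x\in V\}$, and for $S\subseteq V$ let $f^\lambda(S)=\{u_x^1,\dots,u_x^\lambda:x\in S\}$. Then $f^\lambda(\Delta)$ is the simplicial complex on $V^\lambda$ with facets $f^\lambda(F_1),\dots,f^\lambda(F_m)$. PR complexes: $\widetilde{H}_i$ is reduced simplicial homology with coefficients in $\mathbb{K}$ (with $\widetilde H_{-1}(\{\emptyset\})=\mathbb{K}$), and $\mathrm{link}_\Delta\sigma=\{\tau\in\Delta:\sigma\cap\tau=\emptyset,\sigma\cup\tau\in\Delta\}$ for a face $\sigma$. A simplicial complex $\Delta$ is PR (over $\mathbb{K}$) if for every $i\ge-1$ and all faces $\sigma,\tau\in\Delta$ with $\widetilde H_i(\mathrm{link}_\Delta\sigma)\ne0\ne\widetilde H_i(\mathrm{link}_\Delta\tau)$ we have $|\sigma|=|\tau|$. For a PR complex $\Delta$, let $p$ be the maximum index for which some face $\sigma$ has $\widetilde H_{p-1}(\mathrm{link}_\Delta\sigma)\neq0$. For each $0\le i\le p$ faces $\sigma$ with $\widetilde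 H_{i-1}(\mathrm{link}_\Delta\sigma)\ne0$ exist; let $s_i$ be their common size. The degree type of $\Delta$ is $(d_p,\dots,d_1)$ with $d_i=s_{i-1}-s_i$ (these are positive integers). *)

(* Defs.v *)
From HB Require Import structures.
From mathcomp Require Import all_boot all_order all_algebra.

Set Implicit Arguments.
Unset Strict Implicit.
Unset Printing Implicit Defensive.

Import GRing.Theory.
Local Open Scope ring_scope.

Section Complexes.
Variable V : finType.
Implicit Types (D : {set {set V}}) (s t : {set V}).

(* Not every x : V has to be a vertex of D; the void complex is excluded. *)
Definition simplicial_complex D : Prop :=
  set0 \in D /\ (forall s t, s \in D -> t \subset s -> t \in D).

Definition link D s : {set {set V}} :=
  [set t in D | [disjoint s & t] && (s :|: t \in D)].

Definition facets D : {set {set V}} := [set F | maxset (mem D) F].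

End Complexes.

Section Homology.
Variables (K : fieldType) (V : finType).
Implicit Types (D : {set {set V}}) (s t : {set V}) (x y : V) (i : nat).

(* All chain groups live in the space of K-valued functions on subsets of V. *)
Definition chain := {ffun {set V} -> K^o}.

Definition elem_chain s : chain := [ffun t => (t == s)%:R].

(* Simplices are oriented by the order of their vertices in enum V. *)
Definition face_sign s x : K :=
  (-1) ^+ #|[set y in s | (enum_rank y < enum_rank x)%N]|.

Definition elem_boundary s : chain :=
  \sum_(x in s) face_sign s x *: elem_chain (s :\ x).

Definition boundary (c : chain) : chain := \sum_s c s *: elem_boundary s.

Lemma boundary_is_linear : linear boundary.
Proof.
move=> a c d; rewrite /boundary scaler_sumr -big_split /=.
by apply: eq_bigr => s _; rewrite !ffunE scalerDl scalerA.
Qed.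

HB.instance Definition _ :=
  GRing.isLinear.Build K chain chain *:%R boundary boundary_is_linear.

(* Spanned by the faces with i vertices, hence in homological degree i - 1;
   the empty face spans degree -1. *)
Definition chains D i : {vspace chain} :=
  <<[seq elem_chain s | s <- enum [set s in D | #|s| == i]]>>%VS.

Definition cycles D i : {vspace chain} :=
  (chains D i :&: lker (linfun boundary))%VS.

Definition boundaries D i : {vspace chain} :=
  (linfun boundary @: chains D i.+1)%VS.

(* The reduced homology group of degree i - 1 (so i = 0 is degree -1).  The
   quotient cycles / boundaries is realized as a complement of the boundaries
   in the cycles, which contain them by boundaries_sub_cycles below. *)
Definition reduced_homology D i : {vspace chain} :=
  (cycles D i :\: boundaries D i)%VS.

Lemma elem_boundaryE s : boundary (elem_chain s) = elem_boundary s.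
Proof.
rewrite /boundary (bigD1 s) //= ffunE eqxx scale1r big1 ?addr0 // => t tNs.
by rewrite ffunE (negPf tNs) scale0r.
Qed.

Lemma face_sign_swap s x y : x \in s -> (enum_rank x < enum_rank y)%N ->
  face_sign s y * face_sign (s :\ y) x =
  - (face_sign s x * face_sign (s :\ x) y).
Proof.
move=> xs xy; rewrite /face_sign.
have -> : [set z in s :\ y | (enum_rank z < enum_rank x)%N] =
          [set z in s | (enum_rank z < enum_rank x)%N].
  apply/setP=> z; rewrite !inE; case: eqP => //= ->.
  by rewrite [in RHS]ltnNge (ltnW xy) andbF.
have -> : [set z in s | (enum_rank z < enum_rank y)%N] =
          x |: [set z in s :\ x | (enum_rank z < enum_rank y)%N].
  by apply/setP=> z; rewrite !inE; case: eqP => //= ->; rewrite xs xy.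
by rewrite cardsU1 !inE eqxx /= exprS mulN1r mulNr mulrC.
Qed.

Lemma boundaryK (c : chain) : boundary (boundary c) = 0.
Proof.
have H s : boundary (elem_boundary s) = 0.
  rewrite linear_sum /=.
  pose F x y := (face_sign s x * face_sign (s :\ x) y) *: elem_chain (s :\ x :\ y).
  pose lt x y := (enum_rank x < enum_rank y)%N.
  have -> : \sum_(x in s) boundary (face_sign s x *: elem_chain (s :\ x)) =
      \sum_(x in s) (\sum_(y in s | lt x y) F x y + \sum_(y in s | lt y x) F x y).
    apply: eq_bigr => x xs; rewrite linearZ /= elem_boundaryE scaler_sumr.
    rewrite (bigID (lt x)) /=; congr (_ + _).
      apply: eq_big => [y|y _]; last by rewrite scalerA.
      rewrite !inE; case: (eqVneq y x) => [->|//].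
      by rewrite /lt ltnn !andbF.
    apply: eq_big => [y|y _]; last by rewrite scalerA.
    rewrite !inE /lt -leqNgt leq_eqVlt.
    case: (eqVneq y x) => [->|yx]; first by rewrite ltnn !andbF.
    by rewrite (inj_eq val_inj) (inj_eq enum_rank_inj) (negPf yx).
  rewrite big_split /= [X in _ + X](exchange_big_dep (mem s)) /=; last first.
    by move=> x y _ /andP[].
  rewrite -big_split big1 // => x xs /=.
  rewrite -[X in X + _]opprK -sumrN addrC; apply/eqP; rewrite subr_eq0; apply/eqP.
  apply: eq_big => [y|y /and3P[_ _ xy]]; first by rewrite xs.
  by rewrite /F face_sign_swap // scaleNr setDDl setUC -setDDl.
by rewrite [boundary c]/boundary linear_sum big1 //= => s _;
  rewrite linearZ /= H scaler0.
Qed.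

Lemma boundaries_sub_cycles D i :
  (forall s t, s \in D -> t \subset s -> t \in D) ->
  (boundaries D i <= cycles D i)%VS.
Proof.
move=> Ddown; apply/subvP=> _ /memv_imgP[c cC ->].
rewrite memv_cap memv_ker !lfunE /= boundaryK eqxx andbT.
rewrite -[boundary c](lfunE boundary); have := memv_img (linfun boundary) cC.
move: (linfun boundary c) => e; apply: subvP; rewrite /chains limg_span.
apply/span_subvP=> _ /mapP[_ /mapP[s + ->] ->].
rewrite mem_enum inE lfunE /= elem_boundaryE => /andP[sD /eqP si].
rewrite memv_suml // => x xs; rewrite memvZ // memv_span // map_f //.
rewrite mem_enum inE (Ddown _ _ sD) ?subsetDl //=.
by move: si; rewrite (cardsD1 x) xs add1n => -[->].
Qed.

Definition link_homology_neq0 D i s : bool :=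
  (s \in D) && (reduced_homology (link D s) i != 0%VS).

Definition PR D : Prop :=
  simplicial_complex D /\
  forall i s t, link_homology_neq0 D i s -> link_homology_neq0 D i t ->
    #|s| = #|t|.

(* d is listed as (d_p, ..., d_1), where d_i = s_(i-1) - s_i is computed in int,
   so that the subtraction is not truncated. *)
Definition degree_type D (d : seq int) : Prop :=
  exists (p : nat) (sz : nat -> nat),
  [/\ forall i s, link_homology_neq0 D i s -> (i <= p)%N,
      forall i, (i <= p)%N -> exists s, link_homology_neq0 D i s,
      forall i s, (i <= p)%N -> link_homology_neq0 D i s -> #|s| = sz i
    & d = [seq (sz i.-1)%:Z - (sz i)%:Z | i <- rev (iota 1 p)]].

End Homology.

Section Blowup.
Variables (V : finType) (l : nat).

(* The vertex u_x^j is the pair (x, j) : V * 'I_l. *)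
Definition blowup_set (S : {set V}) : {set V * 'I_l} := [set u | u.1 \in S].

Definition blowup (D : {set {set V}}) : {set {set V * 'I_l}} :=
  [set t : {set V * 'I_l} | [exists F in facets D, t \subset blowup_set F]].

End Blowup.

Arguments reduced_homology K {V} D i.
Arguments PR K {V} D.
Arguments degree_type K {V} D d.
Arguments blowup {V} l D.

(* Main.v *)
(* A set t is a face of f^l(D) iff its projection to V is a face of D.  If some
   u_x^j misses t although x lies in the projection of t, the link of t is a
   cone with apex u_x^j, hence acyclic.  Otherwise t = f^l(s), and the link of t
   is f^l(link s).  It remains to see that D and f^l(D) have the same homology:
   u_x^j is dominated by u_x^0, so the vertices u_x^j with j > 0 can be deleted
   one after the other, and what is left is a copy of D. *)
From HB Require Import structures.
Require Import Defs.
From mathcomp Require Import all_boot all_order all_algebra.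

Set Implicit Arguments.
Unset Strict Implicit.
Unset Printing Implicit Defensive.

Import GRing.Theory.
Local Open Scope ring_scope.

(** * Links of faces *)

Section Links.
Variable V : finType.
Implicit Types (D : {set {set V}}) (s t : {set V}).

Lemma mem_link D s t :
  (t \in link D s) = [&& t \in D, [disjoint s & t] & s :|: t \in D].
Proof. by rewrite inE. Qed.

Lemma simplicial_link D s :
  simplicial_complex D -> s \in D -> simplicial_complex (link D s).
Proof.
move=> [D0 downD] sD; split=> [|t t']; rewrite !inE.
  by rewrite D0 setU0 sD -setI_eq0 setI0 eqxx.
move=> /and3P[tD st stD] t't; apply/and3P; split.
- exact: downD tD t't.
- exact: disjointWr t't st.
- by apply: downD stD _; apply: setUS.
Qed.

End Links.

(** * Coordinates of chains, and acyclicity of cones *)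

Section Chains.
Variables (K : fieldType) (V : finType).
Implicit Types (D : {set {set V}}) (s t : {set V}) (v w x y : V).
Implicit Types (c b : chain K V) (i : nat).

Lemma chain_sum c : c = \sum_s c s *: elem_chain K s.
Proof.
apply/ffunP=> t; rewrite sum_ffunE (bigD1 t) //= !ffunE eqxx.
rewrite /GRing.scale /= mulr1 big1 ?addr0 // => s sNt.
by rewrite !ffunE eq_sym (negPf sNt) /GRing.scale /= mulr0.
Qed.

(** The spanning chains are unit vectors, so membership in the span is a condition on the support.
    Chains can then be given by their coefficients. *)
Lemma chainsP D i c :
  reflect (forall s, c s != 0 -> s \in D /\ #|s| = i) (c \in chains K D i).
Proof.
apply: (iffP idP) => [cD s|cD].
  case: (boolP ((s \in D) && (#|s| == i))) => [/andP[? /eqP ?] //|/negP sNDi].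
  case/eqP; rewrite [c](coord_span (X := in_tuple _) cD) sum_ffunE big1 // => j _.
  rewrite ffunE; have /mapP[t + ->] := mem_nth 0 (ltn_ord j).
  rewrite mem_enum inE => /andP[tD /eqP ti]; rewrite ffunE.
  by case: eqP => [st|_]; [case: sNDi; rewrite st tD ti eqxx | rewrite scaler0].
rewrite [c]chain_sum; apply: memv_suml => s _.
have [->|/cD[sD si]] := eqVneq (c s) 0; first by rewrite scale0r mem0v.
by rewrite memvZ // memv_span // map_f // mem_enum inE sD si /=.
Qed.

(** A complement of the boundaries in the cycles is zero iff every cycle is a boundary. Homology is
    used below only through such explicit fillings. *)
Lemma reduced_homology_eq0P D i :
  reflect (forall c, c \in chains K D i -> boundary c = 0 ->
             exists2 b, b \in chains K D i.+1 & boundary b = c)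
          (reduced_homology K D i == 0%VS).
Proof.
rewrite /reduced_homology diffv_eq0; apply: (iffP subvP) => [sub c cD c0|ex c].
  have /sub/memv_imgP[b bD ->] : c \in cycles K D i.
    by rewrite memv_cap cD memv_ker lfunE /= c0 eqxx.
  by exists b; rewrite ?lfunE.
rewrite memv_cap memv_ker lfunE /= => /andP[cD /eqP c0].
have [b bD <-] := ex c cD c0.
by have := memv_img (linfun (@boundary K V)) bD; rewrite lfunE.
Qed.

Lemma face_signK s x : face_sign K s x * face_sign K s x = 1.
Proof. by rewrite -expr2 /face_sign sqrr_sign. Qed.

Lemma face_signU1 s x y : y \notin s ->
  face_sign K (y |: s) x =
  (-1) ^+ (enum_rank y < enum_rank x)%N * face_sign K s x.
Proof.
move=> yNs; rewrite /face_sign -exprD; congr (_ ^+ _).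
have [lt_yx|le_xy] := boolP (enum_rank y < enum_rank x)%N.
  rewrite (_ : [set z in y |: s | _] =
               y |: [set z in s | (enum_rank z < enum_rank x)%N]).
    by rewrite cardsU1 inE (negPf yNs).
  by apply/setP=> z; rewrite !inE; case: eqP => // ->; rewrite lt_yx.
apply: eq_card => z; rewrite !inE; case: eqP => // ->.
by rewrite (negPf le_xy) !andbF.
Qed.

(** Exactly one of [x] and [y] precedes the other, so exactly one of the two factors picks up an
    extra sign. *)
Lemma face_signU1_anti s x y : x \notin s -> y \notin s -> x != y ->
  face_sign K (x |: s) y * face_sign K (y |: s) x =
  - (face_sign K s x * face_sign K s y).
Proof.
move=> xNs yNs xNy; rewrite !face_signU1 // mulrACA -exprD.
case: (ltngtP (enum_rank x) (enum_rank y)) => [_|_|/val_inj/enum_rank_inj xy].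
- by rewrite mulN1r mulrC.
- by rewrite mulN1r mulrC.
by rewrite xy eqxx in xNy.
Qed.

(** Only the cofaces [x |: t] of [t] contribute to the coefficient at [t]. *)
Lemma boundaryE c t :
  boundary c t = \sum_(x | x \notin t) face_sign K t x * c (x |: t).
Proof.
rewrite /boundary sum_ffunE.
under eq_bigr do rewrite ffunE sum_ffunE scaler_sumr.
rewrite (exchange_big_dep predT) //= [LHS](bigID (mem t)) /= big1 ?add0r => [|x xt].
  apply: eq_bigr => x xNt; rewrite (bigD1 (x |: t)) ?setU11 //= !ffunE.
  rewrite setU1K // eqxx big1 ?addr0 => [|s /andP[xs sNt]].
    rewrite face_signU1 // ltnn mul1r.
    by rewrite /GRing.scale /= mulr1 mulrC.
  rewrite !ffunE; case: eqP => [ts|_]; last by rewrite !scaler0.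
  by rewrite ts setD1K ?eqxx in sNt.
apply: big1 => s xs; rewrite !ffunE; case: eqP => [ts|_].
  by rewrite ts setD11 in xt.
by rewrite !scaler0.
Qed.

(** Exterior multiplication by [v] on the left: simplices containing [v] are killed, and the sign
    moves [v] from the front to its place in the vertex order. *)
Definition wedge v c : chain K V :=
  [ffun t : {set V} => if v \in t then face_sign K t v * c (t :\ v) else 0].

(** The Leibniz rule for [v] wedge [c]; equivalently, [wedge v] contracts the full simplex. *)
Lemma boundary_wedge v c : boundary (wedge v c) + wedge v (boundary c) = c.
Proof.
apply/ffunP=> t; rewrite !ffunE; case: ifPn => [vt|vNt]; last first.
  rewrite boundaryE addr0 (bigD1 v) //= ffunE setU11 setU1K // face_signU1 // ltnn mul1r.
  rewrite mulrA face_signK mul1r big1 ?addr0 // => x /andP[xNt xNv].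
  by rewrite ffunE !inE eq_sym (negPf xNv) (negPf vNt) mulr0.
(* At a simplex [t] containing [v], the summand for [v] in the second sum gives [c t]; the remaining
   summands cancel in pairs by [face_signU1_anti]. *)
rewrite !boundaryE [X in _ + _ * X](bigD1 v) ?setD11 //= setD1K //.
have st : face_sign K t v = face_sign K (t :\ v) v.
  by rewrite -{1}(setD1K vt) face_signU1 ?setD11 // ltnn mul1r.
rewrite st mulrDr mulrA face_signK mul1r addrCA mulr_sumr.
rewrite [X in _ + (_ + X)](eq_bigl (fun x => x \notin t)) => [|x]; last first.
  rewrite !inE; case: (eqVneq x v) => [->|_] /=; first by rewrite vt.
  by rewrite andbT.
rewrite -big_split /= big1 ?addr0 // => x xNt.
have xNv : x != v by apply: contraNneq xNt => ->.
rewrite ffunE inE vt orbT.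
have uvN : v \notin t :\ v by rewrite setD11.
have uxN : x \notin t :\ v by rewrite !inE (negPf xNt) andbF.
have -> : (x |: t) :\ v = x |: (t :\ v).
  by apply/setP=> z; rewrite !inE; case: eqVneq => // ->; rewrite eq_sym (negPf xNv).
have -> : face_sign K (x |: t) v = face_sign K (x |: (t :\ v)) v.
  rewrite -{1}(setD1K vt) setUCA [LHS]face_signU1 ?ltnn ?mul1r //.
  by rewrite !inE eq_sym (negPf xNv) eqxx.
rewrite !mulrA -mulrDl -{1}(setD1K vt) face_signU1_anti 1?eq_sym //.
by rewrite addNr mul0r.
Qed.

Lemma wedge_chains D D' i v c :
    (forall s, v \notin s -> c s != 0 -> v |: s \in D' /\ #|s| = i) ->
  wedge v c \in chains K D' i.+1.
Proof.
move=> cD'; apply/chainsP=> s; rewrite ffunE; case: ifPn => [vs|]; last by rewrite eqxx.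
rewrite mulf_eq0 negb_or => /andP[_ /cD'[]]; first by rewrite setD11.
by rewrite setD1K // (cardsD1 v s) vs => ? ->.
Qed.

(** For a cycle [c] the Leibniz rule reads [boundary (wedge v c) = c], and the cone condition keeps
    [wedge v c] inside [D]. *)
Lemma cone_reduced_homology D v i :
  (forall s, s \in D -> v |: s \in D) -> reduced_homology K D i = 0%VS.
Proof.
move=> coneD; apply/eqP/reduced_homology_eq0P => c /chainsP cD c0.
exists (wedge v c); first by apply: (@wedge_chains D) => s _ /cD[/coneD].
rewrite -[RHS](boundary_wedge v) c0 [wedge v 0](_ : _ = 0) ?addr0 //.
by apply/ffunP=> t; rewrite !ffunE mulr0 if_same.
Qed.

End Chains.

(** * Deletion of a dominated vertex *)

Section DominatedVertex.
Variables (K : fieldType) (V : finType).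
Implicit Types (D : {set {set V}}) (s t : {set V}) (v w x y : V).
Implicit Types (c b : chain K V) (i : nat).

(** This projection is not a chain map; [star_defect] computes its commutator with [boundary]. *)
Definition star_part v c : chain K V := [ffun s : {set V} => if v \in s then c s else 0].

(* The chain map replacing v by w in every simplex, written so that its homotopy
   to the identity is visible: for w dominating v, the homotopy
   [wedge w \o star_part v] stays inside the complex. *)
Definition fold_vertex v w c : chain K V :=
  c - (boundary (wedge w (star_part v c)) + wedge w (star_part v (boundary c))).

Lemma wedgeB v c b : wedge v (c - b) = wedge v c - wedge v b.
Proof.
apply/ffunP=> t; rewrite !ffunE; case: ifP => _; last by rewrite subr0.
by rewrite mulrBr.
Qed.

Lemma star_partB v c b : star_part v (c - b) = star_part v c - star_part v b.
Proof. by apply/ffunP=> t; rewrite !ffunE; case: ifP => _; rewrite ?subr0. Qed.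

Lemma wedge0 v : wedge v (0 : chain K V) = 0.
Proof. by rewrite -(subrr 0) wedgeB !subrr. Qed.

Lemma star_part0 v : star_part v (0 : chain K V) = 0.
Proof. by rewrite -(subrr 0) star_partB !subrr. Qed.

Lemma boundary_fold v w c :
  boundary (fold_vertex v w c) = fold_vertex v w (boundary c).
Proof.
by rewrite /fold_vertex raddfB raddfD /= !boundaryK star_part0 wedge0 addr0 add0r.
Qed.

(** The Leibniz rule for [wedge w] cancels the part of [c] through [v]. In this form it becomes
    visible that no simplex containing [v] survives when [v] and [w] differ. *)
Lemma fold_vertexE v w c :
  fold_vertex v w c =
  (c - star_part v c) +
  wedge w (boundary (star_part v c) - star_part v (boundary c)).
Proof.
rewrite /fold_vertex wedgeB opprD !addrA; congr (_ - _).
by rewrite -{2}[star_part v c](boundary_wedge w) opprD addrA addrNK.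
Qed.

Lemma boundary_notin v c t :
  (forall s, v \in s -> c s = 0) -> v \in t -> boundary c t = 0.
Proof.
move=> c0 vt; rewrite boundaryE big1 // => x _.
by rewrite c0 ?mulr0 // inE vt orbT.
Qed.

(** The commutator is contraction by [v]: it removes [v] from the simplices through [v], up to sign,
    and so lives on the link of [v]. *)
Lemma star_defect v c t :
  (boundary (star_part v c) - star_part v (boundary c)) t =
  if v \in t then 0 else face_sign K t v * c (v |: t).
Proof.
rewrite !ffunE; case: ifPn => [vt|vNt].
  rewrite !boundaryE -sumrB big1 // => x _.
  by rewrite ffunE inE vt orbT subrr.
rewrite subr0 boundaryE (bigD1 v) //= ffunE setU11 big1 ?addr0 //.
move=> x /andP[xNt xNv].
by rewrite ffunE !inE eq_sym (negPf xNv) (negPf vNt) mulr0.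
Qed.

(** [fold_vertex v w] retracts the chains of [D] onto those of the deletion and is homotopic to the
    identity within [D], so fillings transfer both ways. *)
Lemma dominated_deletion D v w i : v != w ->
    (forall s t, s \in D -> t \subset s -> t \in D) ->
    (forall s, s \in D -> v \in s -> w |: s \in D) ->
  (reduced_homology K [set s in D | v \notin s] i == 0%VS) =
  (reduced_homology K D i == 0%VS).
Proof.
move=> vNw downD domD; set D' := [set s in D | v \notin s].
have D'P s : s \in D' = (s \in D) && (v \notin s) by rewrite inE.
have subD j c : c \in chains K D' j -> c \in chains K D j.
  by move=> /chainsP cD'; apply/chainsP=> s /cD'[]; rewrite D'P => /andP[].
have HD j c : c \in chains K D j -> wedge w (star_part v c) \in chains K D j.+1.
  move=> /chainsP cD; apply: (@wedge_chains K V D) => s _.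
  rewrite ffunE; case: ifPn => [vs /cD[sD ->]|]; last by rewrite eqxx.
  by rewrite domD.
have foldD j c : c \in chains K D j -> fold_vertex v w c \in chains K D' j.
  move=> /chainsP cD; rewrite fold_vertexE; apply: memvD.
    apply/chainsP=> s; rewrite !ffunE; case: ifPn; first by rewrite subrr eqxx.
    by rewrite D'P => -> ; rewrite subr0 andbT; apply: cD.
  apply/chainsP=> s; rewrite ffunE; case: ifPn => [ws|]; last by rewrite eqxx.
  rewrite star_defect; case: ifPn => [_|]; first by rewrite mulr0 eqxx.
  rewrite !inE negb_and negbK (negPf vNw) /= => vNs.
  rewrite !mulf_eq0 !negb_or => /and3P[_ _ /cD[sD <-]].
  rewrite vNs andbT; split; last first.
    by rewrite cardsU1 !inE (negPf vNs) andbF [LHS](cardsD1 w) ws.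
  (* Here [v |: (s :\ w)] is a face through [v]; by domination adding [w] gives a face, and it
     contains [s]. *)
  apply: downD (domD _ sD (setU11 _ _)) _.
  by rewrite setUCA setD1K // subsetUr.
have foldid j c : c \in chains K D' j -> fold_vertex v w c = c.
  move=> /chainsP cD'.
  have c0 s : v \in s -> c s = 0.
    move=> vs; apply/eqP/negPn/negP => /cD'[].
    by rewrite D'P vs andbF.
  rewrite fold_vertexE (_ : star_part v c = 0).
    rewrite subr0 raddf0 sub0r (_ : star_part v _ = 0) ?oppr0 ?wedge0 ?addr0 //.
    by apply/ffunP=> s; rewrite !ffunE; case: ifP => // vs; rewrite (boundary_notin c0).
  by apply/ffunP=> s; rewrite !ffunE; case: ifP => // /c0.
apply/reduced_homology_eq0P/reduced_homology_eq0P => ex c cD c0.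
  (* From the deletion to [D]: fill the folded cycle, then add the homotopy term, whose boundary is
     [c] minus its fold. *)
  have [|b bD' bc] := ex _ (foldD _ _ cD).
    by rewrite boundary_fold c0 /fold_vertex raddf0 star_part0 wedge0 raddf0 addr0 subr0.
  exists (b + wedge w (star_part v c)); first by apply: memvD; [exact: subD | exact: HD].
  by rewrite raddfD /= bc /fold_vertex c0 star_part0 wedge0 addr0 subrK.
(* From [D] to the deletion: fold a filling found in [D]; folding leaves [c] itself fixed. *)
have [b bD bc] := ex _ (subD _ _ cD) c0.
exists (fold_vertex v w b); first exact: foldD.
by rewrite boundary_fold bc (foldid i).
Qed.

End DominatedVertex.

(** * Transport of homology along an order-preserving injection of vertices *)

Section Pushforward.
Variables (K : fieldType) (V W : finType) (f : V -> W).
Hypothesis f_inj : injective f.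
(** Orientations come from the enumeration order, so monotonicity lets simplices be pushed forward
    without signs. *)
Hypothesis f_mono : forall x y,
  (enum_rank (f x) < enum_rank (f y))%N = (enum_rank x < enum_rank y)%N.
Implicit Types (D : {set {set V}}) (s : {set V}) (c : chain K V).

Definition pushforward c : chain K W := \sum_s c s *: elem_chain K (f @: s).

Lemma pushforward_is_linear : linear pushforward.
Proof.
move=> a c d; rewrite /pushforward scaler_sumr -big_split /=.
by apply: eq_bigr => s _; rewrite !ffunE scalerDl scalerA.
Qed.

HB.instance Definition _ :=
  GRing.isLinear.Build K (chain K V) (chain K W) *:%R pushforward
    pushforward_is_linear.

Lemma pushforward_elem s : pushforward (elem_chain K s) = elem_chain K (f @: s).
Proof.
rewrite /pushforward (bigD1 s) //= ffunE eqxx scale1r big1 ?addr0 // => t tNs.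
by rewrite ffunE (negPf tNs) scale0r.
Qed.

Lemma pushforwardE c s : pushforward c (f @: s) = c s.
Proof.
rewrite [in RHS](chain_sum c) /pushforward !sum_ffunE; apply: eq_bigr => t _.
by rewrite !ffunE (inj_eq (imset_inj f_inj)).
Qed.

Lemma pushforward_inj : injective pushforward.
Proof. by move=> c d cd; apply/ffunP=> s; rewrite -!pushforwardE cd. Qed.

Lemma face_sign_imset s x : face_sign K (f @: s) (f x) = face_sign K s x.
Proof.
rewrite /face_sign; congr (_ ^+ _); rewrite -(card_imset _ f_inj).
apply: eq_card => u; rewrite inE; apply/andP/imsetP => [[/imsetP[y ys ->]]|[y]].
  by rewrite f_mono => yx; exists y; rewrite ?inE ?ys.
by rewrite inE => /andP[ys yx] ->; rewrite imset_f ?f_mono.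
Qed.

Lemma imset_setD1 s x : f @: (s :\ x) = f @: s :\ f x.
Proof.
apply/setP=> u; rewrite !inE; apply/imsetP/andP => [[y + ->]|[uNx /imsetP[y ys uE]]].
  by rewrite !inE (inj_eq f_inj) => /andP[-> ys]; rewrite imset_f.
by exists y; rewrite // !inE ys andbT -(inj_eq f_inj) -uE.
Qed.

Lemma boundary_pushforward c : boundary (pushforward c) = pushforward (boundary c).
Proof.
rewrite {2}/boundary [RHS]raddf_sum [LHS]raddf_sum; apply: eq_bigr => s _ /=.
rewrite !linearZ /= elem_boundaryE /elem_boundary; congr (_ *: _); rewrite [RHS]raddf_sum.
rewrite big_imset /= => [|x y _ _]; last exact: f_inj.
apply: eq_bigr => x _.
by rewrite linearZ /= pushforward_elem face_sign_imset imset_setD1.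
Qed.

Lemma pushforward_chains D i c :
  (pushforward c \in chains K [set f @: (s : {set V}) | s in D] i) =
  (c \in chains K D i).
Proof.
apply/chainsP/chainsP => cD t.
  rewrite -pushforwardE => /cD[]; rewrite mem_imset; last exact: imset_inj.
  by rewrite card_imset.
have [/codomP[s ->]|tNf] := boolP (t \in codom (fun s : {set V} => f @: s)).
  rewrite pushforwardE mem_imset; last exact: imset_inj.
  by rewrite card_imset //; apply: cD.
case/eqP; rewrite sum_ffunE big1 // => s _; rewrite !ffunE.
case: eqP => [ts|_]; last by rewrite scaler0.
by rewrite ts codom_f in tNf.
Qed.

Lemma pushforward_surj D i (b : chain K W) :
  b \in chains K [set f @: (s : {set V}) | s in D] i ->
  exists c, b = pushforward c.
Proof.
move=> /chainsP bD; exists [ffun s : {set V} => b (f @: s)].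
apply/ffunP=> t; have [tD|tND] := boolP (t \in [set f @: (s : {set V}) | s in D]).
  by case/imsetP: tD => s _ ->; rewrite pushforwardE ffunE.
rewrite (_ : b t = 0); last by apply/eqP/negPn/negP => /bD[]; rewrite (negPf tND).
have [/codomP[s ts]|tNf] := boolP (t \in codom (fun s : {set V} => f @: s)).
  rewrite ts pushforwardE ffunE; apply/esym/eqP/negPn/negP => /bD[].
  by rewrite -ts (negPf tND).
rewrite sum_ffunE big1 // => s _; rewrite !ffunE.
case: eqP => [ts|_]; last by rewrite scaler0.
by rewrite ts codom_f in tNf.
Qed.

(** [pushforward] is an isomorphism from the chain complex of [D] onto that of its image, so cycles
    and fillings correspond. *)
Lemma imset_reduced_homology D i :
  (reduced_homology K [set f @: (s : {set V}) | s in D] i == 0%VS) =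
  (reduced_homology K D i == 0%VS).
Proof.
apply/reduced_homology_eq0P/reduced_homology_eq0P => ex c cD c0.
  have [||b bD bc] := ex (pushforward c); first by rewrite pushforward_chains.
    by rewrite boundary_pushforward c0 raddf0.
  have [b' b'E] := pushforward_surj bD; move: bD bc; rewrite b'E.
  rewrite pushforward_chains boundary_pushforward => b'D /pushforward_inj.
  by exists b'.
have [c' cE] := pushforward_surj cD; move: cD c0; rewrite cE.
rewrite pushforward_chains boundary_pushforward -(raddf0 pushforward) => c'D.
move=> /pushforward_inj c'0; have [b bD bc] := ex c' c'D c'0.
by exists (pushforward b); rewrite ?pushforward_chains // boundary_pushforward bc.
Qed.

End Pushforward.

(** * The enumeration order of a product *)

Section ProductRank.
Variables (T1 T2 : finType).

(** The list of pairs consists of consecutive rows of length [size t], one for each entry of [s]. *)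
Lemma index_allpairs (T1' T2' : eqType) (s : seq T1') (t : seq T2') x y :
  x \in s -> y \in t ->
  index (x, y) [seq (a, b) | a <- s, b <- t] = (index x s * size t + index y t)%N.
Proof.
move=> + yt; elim: s => //= a s IHs; rewrite inE index_cat.
have [->|ax] := eqVneq x a => [_|/= xs].
  by rewrite map_f // index_map // => b b' [].
rewrite ifF; last by apply/mapP=> -[b _ [xa]]; rewrite xa eqxx in ax.
by rewrite size_map IHs // mulSn addnA.
Qed.

Lemma index_enum_rank (T : finType) (x : T) : index x (enum T) = enum_rank x.
Proof. by rewrite -{1}(nth_enum_rank x x) index_uniq ?enum_uniq // -cardE. Qed.

(** Supplies the monotonicity needed to push chains forward along the embedding of [T1] at level
    [z]. *)
Lemma enum_rank_pair_ltn (x y : T1) (z : T2) :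
  (enum_rank (x, z) < enum_rank (y, z))%N = (enum_rank x < enum_rank y)%N.
Proof.
rewrite -!index_enum_rank.
have -> : enum ((T1 * T2)%type : finType) = [seq (a, b) | a <- enum T1, b <- enum T2].
  by rewrite enumT unlock.
rewrite !index_allpairs ?mem_enum // ltn_add2r ltn_pmul2r //.
by rewrite -cardE; apply/card_gt0P; exists z.
Qed.

End ProductRank.

(** * Faces, homology and links of the blowup *)

Section Blowup.
Variables (K : fieldType) (V : finType) (l : nat).
Implicit Types (D : {set {set V}}) (s F : {set V}) (t : {set V * 'I_l}).

Lemma sub_blowup_set t F : (t \subset blowup_set l F) = ([set u.1 | u in t] \subset F).
Proof.
apply/subsetP/subsetP => [sub _ /imsetP[u ut ->]|sub u ut].
  by have := sub u ut; rewrite inE.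
by rewrite inE sub // imset_f.
Qed.

Lemma mem_blowup D t :
  simplicial_complex D -> (t \in blowup l D) = ([set u.1 | u in t] \in D).
Proof.
move=> [_ downD]; rewrite inE; apply/existsP/idP => [[F /andP[]]|tD].
  by rewrite inE sub_blowup_set => /maxsetp FD /(downD _ _ FD).
have [F Fmax sF] := maxset_exists (P := mem D) tD.
by exists F; rewrite sub_blowup_set sF inE Fmax.
Qed.

Lemma simplicial_blowup D : simplicial_complex D -> simplicial_complex (blowup l D).
Proof.
move=> sD; split=> [|t t']; rewrite !mem_blowup //; first by rewrite imset0; case: sD.
by move=> tD /(imsetS (fun u => u.1)); apply: (proj2 sD).
Qed.

Lemma blowup_reduced_homology D i : (0 < l)%N -> simplicial_complex D ->
  (reduced_homology K (blowup l D) i == 0%VS) = (reduced_homology K D i == 0%VS).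
Proof.
move=> l_gt0 sD; pose j0 := Ordinal l_gt0.
(* [X A] is the blowup with the vertices in [A] deleted; [XE] deletes them one at a time, by
   induction on [A]. *)
pose X (A : seq (V * 'I_l)) := [set t in blowup l D | all (fun u => u \notin t) A].
have XP A t : (t \in X A) = (t \in blowup l D) && all (fun u => u \notin t) A.
  by rewrite in_set.
have XE A : {in A, forall u, u.2 != j0} ->
    (reduced_homology K (blowup l D) i == 0%VS) = (reduced_homology K (X A) i == 0%VS).
  elim: A => [|v A IHA] Aj0.
    by have -> : X [::] = blowup l D by apply/setP=> t; rewrite XP andbT.
  rewrite IHA => [|u uA]; last by apply: Aj0; rewrite inE uA orbT.
  have -> : X (v :: A) = [set t in X A | v \notin t].
    by apply/setP=> t; rewrite in_set !XP /= -andbA; congr (_ && _); rewrite andbC.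
  apply/esym/(@dominated_deletion _ _ _ _ (v.1, j0)).
  - apply: contraTneq isT => vE.
    by have := Aj0 v (mem_head _ _); rewrite vE eqxx.
  - move=> t t'; rewrite !XP => /andP[tD At] t't.
    rewrite (proj2 (simplicial_blowup sD) _ _ tD) //=.
    by apply: sub_all At => u; apply/contra/(subsetP t't).
  (* Adding [(v.1, j0)] to a face through [v] does not change its projection, and this vertex was
     never deleted because [A] avoids level [j0]. *)
  - move=> t; rewrite !XP => /andP[+ At] vt.
    rewrite !mem_blowup // imsetU1 /= (setUidPr _) ?sub1set ?imset_f // => -> /=.
    apply/allP=> u uA; rewrite !inE negb_or (allP At) // andbT.
    apply: contraTneq isT => uE.
    by have := Aj0 u; rewrite inE uA orbT uE eqxx => /(_ isT).
rewrite (XE [seq u <- enum {: V * 'I_l} | u.2 != j0]) => [|u]; last first.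
  by rewrite mem_filter => /andP[].
pose f x : V * 'I_l := (x, j0).
have f_inj : injective f by move=> x y [].
rewrite -(imset_reduced_homology K f_inj (fun x y => enum_rank_pair_ltn x y j0)).
congr (reduced_homology K (_ : {set {set V * 'I_l}}) i == 0%VS).
(* A face that survives all deletions lies in level [j0], so it is the copy under [f] of its
   projection. *)
apply/setP=> t; rewrite XP mem_blowup //; apply/andP/imsetP => [[tD /allP tj0]|[s sD' ->]].
  exists [set u.1 | u in t] => //; rewrite -imset_comp.
  rewrite -[LHS]imset_id; apply: eq_in_imset => -[x j] xjt /=; congr (_, _).
  apply/eqP; apply: contraTT xjt => jj0; apply: tj0.
  by rewrite mem_filter jj0 mem_enum.
split; first by rewrite -imset_comp (eq_imset (g := id)) ?imset_id.
apply/allP=> u; rewrite mem_filter => /andP[uj0 _].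
by apply: contra uj0 => /imsetP[x _ ->].
Qed.

Lemma card_blowup_set s : #|blowup_set l s| = (#|s| * l)%N.
Proof.
rewrite -[l in RHS]card_ord -cardsT -cardsX; apply: eq_card => u.
by rewrite !inE andbT.
Qed.

Lemma fst_blowup_set s : (0 < l)%N -> [set u.1 | u in blowup_set l s] = s.
Proof.
move=> l_gt0; apply/setP=> x; apply/imsetP/idP => [[u + ->]|xs]; first by rewrite inE.
by exists (x, Ordinal l_gt0); rewrite ?inE.
Qed.

Lemma link_blowup_set D s : (0 < l)%N -> simplicial_complex D -> s \in D ->
  link (blowup l D) (blowup_set l s) = blowup l (link D s).
Proof.
move=> l_gt0 cD sD; apply/setP=> t; rewrite mem_blowup; last exact: simplicial_link.
rewrite [LHS]inE [RHS]inE !mem_blowup // imsetU fst_blowup_set //.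
congr [&& _, _ & _].
(* [blowup_set l s] is a union of full fibres of the projection, so [t] avoids it iff the projection
   of [t] avoids [s]. *)
rewrite !disjoints_subset; apply/subsetP/subsetP => [st x xs|st u].
  rewrite inE; apply/imsetP=> -[u ut xE].
  by have := st u; rewrite !inE -xE xs ut => /(_ isT).
by rewrite !inE => /st; rewrite inE; apply: contra; apply: imset_f.
Qed.

Lemma link_homology_blowup D i t : (0 < l)%N -> simplicial_complex D ->
  reflect (exists2 s, t = blowup_set l s & link_homology_neq0 K D i s)
          (link_homology_neq0 K (blowup l D) i t).
Proof.
move=> l_gt0 cD; rewrite /link_homology_neq0 mem_blowup //.
apply: (iffP andP) => [[sD]|[s -> /andP[sD]]]; last first.
  rewrite fst_blowup_set // link_blowup_set // blowup_reduced_homology //.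
  exact: simplicial_link.
have [tE|] := eqVneq t (blowup_set l [set u.1 | u in t]).
  rewrite {1}tE link_blowup_set // blowup_reduced_homology; last exact: simplicial_link.
    by exists [set u.1 | u in t]; rewrite ?sD.
  by [].
rewrite eqEsubset sub_blowup_set subxx /= => /subsetPn[v].
rewrite inE => /imsetP[u ut vuE] vNt.
(* The missing vertex [v] lies over the same point as some [u] in [t], so adding [v] to a face of
   the link does not change the projection of its union with [t]. *)
rewrite (cone_reduced_homology K (v := v)) ?eqxx // => t'.
have fstU (r : {set V * 'I_l}) :
    [set u.1 | u in t :|: (v |: r)] = [set u.1 | u in t :|: r].
  rewrite setUCA imsetU1 vuE (setUidPr _) // sub1set.
  by apply: imset_f; rewrite inE ut.
rewrite !mem_link !mem_blowup // fstU => /and3P[_ tt' tt'D].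
rewrite tt'D andbT; apply/andP; split.
  by apply: (proj2 cD) tt'D _; rewrite -fstU imsetS // subsetUr.
by rewrite disjoint_sym disjoints_subset subUset sub1set inE vNt -disjoints_subset
  disjoint_sym.
Qed.

End Blowup.

Theorem corollary6p3 (K : fieldType) (V : finType) (D : {set {set V}})
    (d : seq int) (l : nat) :
  PR K D -> degree_type K D d -> (0 < l)%N ->
  PR K (blowup l D) /\
  degree_type K (blowup l D) [seq (l%:Z * x)%R | x <- d].
Proof.
move=> [sD prD] [p [sz [le_p ex_p szE dE]]] l_gt0.
have hP i t := @link_homology_blowup K V l D i t l_gt0 sD.
split; [split|].
- exact: simplicial_blowup.
- move=> i t t' /hP[s -> hs] /hP[s' -> hs'].
  by rewrite !card_blowup_set (prD i s s').
(* Homology degrees are unchanged, so [p] stays; each relevant face is replaced by its blowup, which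
   has [l] times as many vertices. *)
exists p, (fun i => sz i * l)%N; split.
- by move=> i t /hP[s _ /le_p].
- move=> i /ex_p[s hs]; exists (blowup_set l s); apply/hP; exists s => //.
- by move=> i t ip /hP[s -> hs]; rewrite card_blowup_set (szE i).
rewrite dE -map_comp; apply: eq_map => i /=.
by rewrite !PoszM mulrBr ![_ * l%:Z]mulrC.
Qed.
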